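(* Let $\Phi=(\varphi_n)_{n\in\mathbb N}$ and $\Psi=(\psi_n)_{n\in\mathbb N}$ be two frames for a separable Hilbert space $\mathcal H$ with Bessel bounds $M_\Phi$ and $M_\Psi$, respectively. Then $\Psi$ is an approximately dual frame of $\Phi$ if and only if there exists an operator $\mathcal D\in B(\mathcal H)$ such that $T_\Phi U_\Psi=S_\Phi^{1/2}\mathcal D$, $\mathcal D\mathcal D^*\le M_\Psi\, Id_{\mathcal H}$ and $\|Id_{\mathcal H}-S_\Phi^{1/2}\mathcal D\|<1$.
   Context: $\mathcal H$ is a separable Hilbert space, $B(\mathcal H)$ the bounded linear operators on $\mathcal H$, $Id_{\mathcal H}$ the identity operator. A sequence $\Phi=(\varphi_n)_{n\in\mathbb N}$ in $\mathcal H$ is a frame if there are constants $m_\Phi,M_\Phi>0$ with $m_\Phi\|f\|^2\le\sum_{n}|\langle f,\varphi_n\rangle|^2\le M_\Phi\|f\|^2$ for all $f\in\mathcal H$; it is a Bessel sequence with Bessel bound $M_\Phi$ if the second inequality holds. For a Bessel sequence $\Phi$: the analysis operator is $U_\Phi:\mathcal H\to\ell^2$, $U_\Phi f=(\langle f,\varphi_n\rangle)_n$; the synthesis operator is $T_\Phi:\ell^2\to\mathcal H$, $T_\Phi((c_n)_n)=\sum_n c_n\varphi_n$; the frame operator is $S_\Phi=T_\Phi U_\Phi$. For a frame $\Phi$, $S_\Phi$ is bounded, positive and invertible, and $S_\Phi^{1/2}$ is its positive square root. Two Bessel sequences $\Phi,\Psi$ are approximately dual frames if $\|Id_{\mathcal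 H}-T_\Phi U_\Psi\|<1$ or $\|Id_{\mathcal H}-T_\Psi U_\Phi\|<1$ (equivalent conditions, by taking adjoints). *)

(* Defs.v *)
From mathcomp Require Import all_boot all_order all_algebra sesquilinear.
From mathcomp Require Import complex.
From mathcomp Require Import all_classical all_reals all_analysis.

Set Implicit Arguments.
Unset Strict Implicit.
Unset Printing Implicit Defensive.

Import Order.TTheory GRing.Theory Num.Theory.
Import numFieldNormedType.Exports.

Local Open Scope classical_set_scope.
Local Open Scope ring_scope.

(* Hilbert spaces are real or complex; [scalar_field R k] is [R] or [R[i]]. *)
Inductive scalar_kind := RealScalars | ComplexScalars.

Definition scalar_field (R : realType) (k : scalar_kind) : numFieldType :=
  match k with RealScalars => R | ComplexScalars => R[i] end.

Definition scalar_conj (R : realType) (k : scalar_kind) :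
    scalar_field R k -> scalar_field R k :=
  match k with
  | RealScalars => fun x : R => x
  | ComplexScalars => fun z : R[i] => conjc z
  end.

Definition scalar_Re (R : realType) (k : scalar_kind) : scalar_field R k -> R :=
  match k with
  | RealScalars => fun x : R => x
  | ComplexScalars => fun z : R[i] => complex.Re z
  end.

Definition scalar_of (R : realType) (k : scalar_kind) : R -> scalar_field R k :=
  match k with
  | RealScalars => fun x : R => x
  | ComplexScalars => fun x : R => real_complex R x
  end.

(* The norm of a normed space over [K] takes its values in [K], so for complex
   scalars it is a complex number with zero imaginary part. *)
Definition real_norm (R : realType) (k : scalar_kind)
    (V : normedModType (scalar_field R k)) (v : V) : R := scalar_Re `|v|.

Definition scalar_abs (R : realType) (k : scalar_kind) (x : scalar_field R k) : R :=
  scalar_Re `|x|.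

Definition separable_space (T : topologicalType) :=
  exists2 A : set T, countable A & dense A.

Section Hilbert.
Variables (R : realType) (k : scalar_kind).
Local Notation K := (scalar_field R k).
Variables (H : completeNormedModType K) (dot : {dot H for @scalar_conj R k}).

(* Together with the completeness of [H], makes [(H, dot)] a Hilbert space.
   [dot] is linear in its first argument and conjugate-linear in its second. *)
Definition norm_from_dot := forall f : H, `|f| ^+ 2 = dot f f.

(* [+oo] if [A] is unbounded *)
Definition opnorm (A : H -> H) : \bar R :=
  ereal_sup [set (real_norm (A f))%:E | f in [set f : H | real_norm f <= 1]].

(* membership in B(H) *)
Definition bounded_operator (A : H -> H) := linear A /\ (opnorm A < +oo)%E.

(* Unique when it exists, which the Riesz theorem gives for [A] in B(H). *)
Definition adjoint (A : H -> H) : H -> H :=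
  xget (fun _ => 0) [set B : H -> H |
    bounded_operator B /\ forall f g, dot (A f) g = dot f (B g)].

(* Self-adjointness is automatic for complex scalars. *)
Definition positive_operator (A : H -> H) :=
  [/\ bounded_operator A, forall f g, dot (A f) g = dot f (A g)
    & forall f, 0 <= dot (A f) f].

Definition le_operator (A B : H -> H) := positive_operator (B \- A).

Definition sqrt_operator (A : H -> H) : H -> H :=
  xget (fun _ => 0) [set Q : H -> H | positive_operator Q /\ Q \o Q = A].

Definition square_sum (Phi : nat -> H) (f : H) : \bar R :=
  (\sum_(0 <= n <oo) (scalar_abs (dot f (Phi n)) ^+ 2)%:E)%E.

Definition is_bessel_bound (Phi : nat -> H) (M : R) :=
  0 < M /\ forall f, (square_sum Phi f <= (M * real_norm f ^+ 2)%:E)%E.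

Definition bessel_sequence (Phi : nat -> H) := exists M, is_bessel_bound Phi M.

Definition frame (Phi : nat -> H) :=
  exists m M : R, [/\ 0 < m, 0 < M & forall f,
    ((m * real_norm f ^+ 2)%:E <= square_sum Phi f <=
     (M * real_norm f ^+ 2)%:E)%E].

(* For a Bessel sequence the values of [analysis] are in l^2, and the series in
   [synthesis] converges for every [c] in l^2; outside of this case [lim] is a
   default value. *)
Definition analysis (Phi : nat -> H) (f : H) : nat -> K :=
  fun n => dot f (Phi n).

Definition synthesis (Phi : nat -> H) (c : nat -> K) : H :=
  lim (series (fun n => c n *: Phi n) @ \oo).

Definition frame_operator (Phi : nat -> H) : H -> H :=
  synthesis Phi \o analysis Phi.

Definition approximately_dual (Phi Psi : nat -> H) :=
  [/\ bessel_sequence Phi, bessel_sequence Psi &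
    (opnorm (idfun \- (synthesis Phi \o analysis Psi))%R < 1)%E \/
    (opnorm (idfun \- (synthesis Psi \o analysis Phi))%R < 1)%E].

End Hilbert.

(* Main.v *)
(* Given approximately dual frames, take [D = S_Phi^{-1/2} T_Phi U_Psi], whose
   adjoint is [T_Psi U_Phi S_Phi^{-1/2}]; as [|T_Psi c|^2 <= M_Psi |c|^2] and
   [|U_Phi g|^2 = <S_Phi g, g>], one gets [|D^* f|^2 <= M_Psi |f|^2], which is
   [D D^* <= M_Psi]. The converse is immediate.

   Adjoints are always exhibited explicitly, so Riesz representation is not needed,
   and neither is uniqueness of the positive square root: only [Q >= 0] and
   [Q^2 = S_Phi] are used of [Q = S_Phi^{1/2}]. Its existence comes from writing
   [S_Phi / (M + m) = 1 - B] with [|B| < 1] and solving [Y = (B + Y^2) / 2] by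
   iteration, since then [(1 - Y)^2 = 1 - B]. *)
Require Import Defs.
From mathcomp Require Import all_boot all_order all_algebra sesquilinear.
From mathcomp Require Import complex.
From mathcomp Require Import all_classical all_reals all_analysis.
From mathcomp Require Import ssrAC ring lra.

Set Implicit Arguments.
Unset Strict Implicit.
Unset Printing Implicit Defensive.

Import Order.TTheory GRing.Theory Num.Theory.
Import numFieldNormedType.Exports.

Local Open Scope classical_set_scope.
Local Open Scope ring_scope.

(** * Real and complex scalars handled uniformly *)

Section Scalars.
Variables (R : realType) (k : scalar_kind).
Local Notation K := (scalar_field R k).
Implicit Types (x y : K) (r s : R).

Lemma scalar_ReD x y : scalar_Re (x + y) = scalar_Re x + scalar_Re y.
Proof. by case: k x y => //= -[? ?] [? ?]. Qed.

Lemma scalar_ReN x : scalar_Re (- x) = - scalar_Re x.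
Proof. by case: k x => //= -[? ?]. Qed.

Lemma scalar_Re0 : scalar_Re (0 : K) = 0.
Proof. by case: k. Qed.

Lemma scalar_ofK : cancel (@scalar_of R k) (@scalar_Re R k).
Proof. by case: k. Qed.

Lemma scalar_ofD r s : scalar_of k (r + s) = scalar_of k r + scalar_of k s.
Proof. by case: k => //=; rewrite rmorphD. Qed.

Lemma scalar_ofM r s : scalar_of k (r * s) = scalar_of k r * scalar_of k s.
Proof. by case: k => //=; rewrite rmorphM. Qed.

Lemma scalar_of1 : scalar_of k 1 = 1 :> K.
Proof. by case: k => //=; rewrite rmorph1. Qed.

Lemma scalar_of0 : scalar_of k 0 = 0 :> K.
Proof. by case: k => //=; rewrite rmorph0. Qed.

Lemma scalar_of_le r s : (scalar_of k r <= scalar_of k s) = (r <= s).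
Proof. by case: k => //=; rewrite lecR. Qed.

Lemma scalar_of_lt r s : (scalar_of k r < scalar_of k s) = (r < s).
Proof. by case: k => //=; rewrite ltcR. Qed.

Lemma scalar_ReK x : 0 <= x -> scalar_of k (scalar_Re x) = x.
Proof. by case: k x => //= x /ger0_real /RRe_real. Qed.

Lemma scalar_Re_ofM r x : scalar_Re (scalar_of k r * x) = r * scalar_Re x.
Proof. by case: k x => //= -[a b] /=; rewrite mul0r subr0. Qed.

Lemma scalar_norm x : `|x| = scalar_of k (scalar_abs x).
Proof. by rewrite scalar_ReK. Qed.

Lemma scalar_of_inj : injective (@scalar_of R k).
Proof. exact: can_inj scalar_ofK. Qed.

Lemma scalar_absM x y : scalar_abs (x * y) = scalar_abs x * scalar_abs y.
Proof. by apply: scalar_of_inj; rewrite scalar_ofM -!scalar_norm normrM. Qed.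

Lemma scalar_abs_ge0 x : 0 <= scalar_abs x.
Proof. by rewrite -scalar_of_le scalar_of0 -scalar_norm. Qed.

Lemma scalar_absN x : scalar_abs (- x) = scalar_abs x.
Proof. by rewrite /scalar_abs normrN. Qed.

Lemma scalar_absD x y : scalar_abs (x + y) <= scalar_abs x + scalar_abs y.
Proof. by rewrite -scalar_of_le scalar_ofD -!scalar_norm ler_normD. Qed.

Lemma scalar_abs_eq0 x : scalar_abs x = 0 -> x = 0.
Proof. by move=> h; apply/eqP; rewrite -normr_eq0 scalar_norm h scalar_of0. Qed.

Lemma scalar_abs_of r : 0 <= r -> scalar_abs (scalar_of k r) = r.
Proof.
move=> r0; apply: scalar_of_inj; rewrite -scalar_norm ger0_norm //.
by rewrite -scalar_of0 scalar_of_le.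
Qed.

Lemma scalar_Re_le_abs x : scalar_Re x <= scalar_abs x.
Proof.
rewrite -scalar_of_le -scalar_norm; case: k x => /= x; first exact: ler_norm.
by apply: le_trans (normc_ge_Re x); rewrite lecR ler_norm.
Qed.

Lemma scalar_conjM x y : scalar_conj (x * y) = scalar_conj x * scalar_conj y.
Proof. by case: k x y => //= x y; rewrite rmorphM. Qed.

Lemma scalar_conj_of r : scalar_conj (scalar_of k r) = scalar_of k r.
Proof. by case: k => //=; rewrite oppr0. Qed.

Lemma scalar_Re_conj x : scalar_Re (scalar_conj x) = scalar_Re x.
Proof. by case: k x => //= -[]. Qed.

Lemma scalar_abs_conj x : scalar_abs (scalar_conj x) = scalar_abs x.
Proof. by case: k x => // x; congr complex.Re; exact: normcJ. Qed.

Lemma scalar_mul_conj x : x * scalar_conj x = scalar_of k (scalar_abs x ^+ 2).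
Proof.
rewrite expr2 scalar_ofM -scalar_norm -expr2.
by case: k x => /= x; rewrite ?sqr_normc // real_normK ?num_real ?expr2.
Qed.

(** In the partial order on [R[i]] a nonnegative number must have zero imaginary part, which is what
    invariance under conjugation supplies. *)
Lemma scalar_conj_ge0 x : scalar_conj x = x -> 0 <= scalar_Re x -> 0 <= x.
Proof.
case: k x => //= -[a b] [] /eqP; rewrite eqNr => /eqP ->.
by rewrite -(ler0c a).
Qed.

End Scalars.

(** * Real-valued norms, convergence and completeness *)

Section Norms.
Variables (R : realType) (k : scalar_kind).
Local Notation K := (scalar_field R k).
Variable (H : completeNormedModType K).
Implicit Types (f g l : H) (u : nat -> H) (r : R).
Local Notation N := (@real_norm R k H).

Lemma norm_scalar_of f : `|f| = scalar_of k (N f).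
Proof. by rewrite /real_norm scalar_ReK. Qed.

Lemma real_norm_ge0 f : 0 <= N f.
Proof. by rewrite -(scalar_of_le k) scalar_of0 -norm_scalar_of. Qed.
Hint Resolve real_norm_ge0 : core.

Lemma real_norm_eq0 f : N f = 0 -> f = 0.
Proof. by move=> h; apply/eqP; rewrite -normr_eq0 norm_scalar_of h scalar_of0. Qed.

Lemma real_norm0 : N 0 = 0.
Proof. by rewrite /real_norm normr0 scalar_Re0. Qed.

Lemma real_normN f : N (- f) = N f.
Proof. by rewrite /real_norm normrN. Qed.

Lemma real_norm_distC f g : N (f - g) = N (g - f).
Proof. by rewrite -real_normN opprB. Qed.

Lemma real_normD f g : N (f + g) <= N f + N g.
Proof.
by rewrite -(scalar_of_le k) scalar_ofD -!norm_scalar_of ler_normD.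
Qed.

Lemma real_normB f g : N (f - g) <= N f + N g.
Proof. by rewrite (le_trans (real_normD _ _)) // real_normN. Qed.

Lemma real_norm_sub f g l : N (f - g) <= N (f - l) + N (l - g).
Proof. by rewrite (le_trans _ (real_normD _ _)) // addrA subrK. Qed.

Lemma real_normZ (a : K) f : N (a *: f) = scalar_abs a * N f.
Proof.
apply: (@scalar_of_inj R k).
by rewrite scalar_ofM -!norm_scalar_of -scalar_norm normrZ.
Qed.

Lemma real_normZof r f : 0 <= r -> N (scalar_of k r *: f) = r * N f.
Proof. by move=> r0; rewrite real_normZ scalar_abs_of. Qed.

(** Norm convergence is phrased through a sequence in [R], so that squeezing and limit arithmetic
    take place there and not in [K]. *)
Definition norm_tends u l := (fun n => N (u n - l)) @ \oo --> (0 : R).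

Lemma norm_tendsP u l : u @ \oo --> l <-> norm_tends u l.
Proof.
split=> [/cvgrPdist_lt h|/cvgrPdist_lt h].
  apply/cvgrPdist_lt => e e0.
  have /h : 0 < scalar_of k e by rewrite -(scalar_of0 R k) scalar_of_lt.
  apply: filterS => n; rewrite norm_scalar_of scalar_of_lt.
  by rewrite sub0r normrN ger0_norm // real_norm_distC.
apply/cvgrPdist_lt => e e0.
(* A positive element of [K] is real, so [e] is the image of a real number. *)
have E := scalar_ReK (ltW e0); move: e0; rewrite -E -(scalar_of0 R k) scalar_of_lt.
move=> /h; apply: filterS => n.
by rewrite norm_scalar_of scalar_of_lt sub0r normrN ger0_norm // real_norm_distC.
Qed.

Lemma cauchy_norm_tends u (v : nat -> R) : v @ \oo --> (0 : R) ->
  (forall m n, (m <= n)%N -> N (u n - u m) <= v m) -> exists l, norm_tends u l.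
Proof.
move=> /cvgrPdist_lt v0 uv.
suff /cauchy_cvgP h : cauchy (u @ \oo).
  by exists (lim (u @ \oo)); apply/norm_tendsP.
apply/cauchy_exP => e e0.
have E := scalar_ReK (ltW e0); move: e0; rewrite -E -(scalar_of0 R k) scalar_of_lt.
move=> /v0 [m _ hm]; exists (u m).
exists m => // n /= mn; rewrite -ball_normE /= norm_scalar_of scalar_of_lt.
rewrite real_norm_distC (le_lt_trans (uv _ _ mn)) //.
by have /= := hm m (leqnn m); rewrite sub0r normrN => /(le_lt_trans (ler_norm _)).
Qed.

Lemma le_of_cvg0 (x a : R) (v : nat -> R) : v @ \oo --> (0 : R) ->
  (forall n, x <= a + v n) -> x <= a.
Proof.
move=> v0 h; rewrite -[a]addr0.
have av : (fun n => a + v n) @ \oo --> a + 0 by apply: cvgD => //; exact: cvg_cst.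
by rewrite -(cvg_lim (@Rhausdorff R) av); apply: limr_ge;
  [apply/cvg_ex; eexists; exact: av | exact: nearW].
Qed.

Lemma eq_of_norm_le f g (v : nat -> R) : v @ \oo --> (0 : R) ->
  (forall n, N (f - g) <= v n) -> f = g.
Proof.
move=> v0 h; apply/eqP; rewrite -subr_eq0; apply/eqP/real_norm_eq0.
apply/eqP; rewrite eq_le real_norm_ge0 andbT.
by apply: (le_of_cvg0 v0) => n; rewrite add0r.
Qed.

Lemma real_norm_lim_le u l (a : R) :
  norm_tends u l -> (forall n, N (u n) <= a) -> N l <= a.
Proof.
move=> ul h; apply: (le_of_cvg0 ul) => n.
have := real_normB (u n) (u n - l).
by rewrite opprB addrCA subrr addr0; have := h n; lra.
Qed.

(** The steps are dominated by a geometric series, whose tail from [m] on is [a / (1 - q) * q ^+ m];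
    completeness does the rest. *)
Lemma geometric_norm_tends u (a q : R) : 0 <= q -> q < 1 ->
  (forall n, N (u n.+1 - u n) <= a * q ^+ n) -> exists l, norm_tends u l.
Proof.
move=> q0 q1 h.
have a0 : 0 <= a by have := h 0; rewrite expr0 mulr1; apply: le_trans.
apply: (@cauchy_norm_tends u (fun n => a / (1 - q) * q ^+ n)).
  rewrite -[X in _ --> X](mulr0 (a / (1 - q))); apply: cvgMr.
  by apply: cvg_expr; rewrite ger0_norm.
move=> m n mn.
(* Keeping [- q ^+ n] makes the induction on [n] close: one more step costs [a * q ^+ n], which
   equals [a / (1 - q) * (q ^+ n - q ^+ n.+1)]. *)
suff : N (u n - u m) <= a / (1 - q) * (q ^+ m - q ^+ n).
  move=> /le_trans; apply; apply: ler_wpM2l.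
    by rewrite divr_ge0 // subr_ge0 ltW.
  by rewrite gerBl exprn_ge0.
have q1' : 1 - q != 0 by rewrite subr_eq0 gt_eqF.
elim: n mn => [|n IH]; first by rewrite leqn0 => /eqP ->; rewrite !subrr mulr0 real_norm0.
rewrite leq_eqVlt => /orP[/eqP ->|/IH{}IH]; first by rewrite !subrr mulr0 real_norm0.
apply: le_trans (real_norm_sub _ _ (u n)) _.
rewrite (le_trans (lerD (h n) IH)) // exprS le_eqVlt; apply/orP; left; apply/eqP.
by field.
Qed.

End Norms.
#[export] Hint Extern 0 (is_true (0 <= real_norm _)) => exact: real_norm_ge0 : core.

(** The discriminant criterion, including the degenerate case where the leading coefficient
    vanishes. *)
Lemma sqr_le_of_quadratic_ge0 (R : realType) (p q r : R) : 0 <= r ->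
  (forall t, 0 <= p - t * q *+ 2 + t ^+ 2 * r) -> q ^+ 2 <= p * r.
Proof.
rewrite le_eqVlt => /orP[/eqP <-|r0] h.
  have [->|q0] := eqVneq q 0; first by rewrite expr0n mulr0.
  (* At this [t] the affine function [p - t * q *+ 2] takes the value -1. *)
  have := h ((p + 1) / (q *+ 2)).
  have -> : (p + 1) / (q *+ 2) * q *+ 2 = p + 1 by field.
  rewrite mulr0; lra.
(* The minimizer of the quadratic. *)
have := h (q / r); have rn : r != 0 by rewrite gt_eqF.
have -> : p - q / r * q *+ 2 + (q / r) ^+ 2 * r = (p * r - q ^+ 2) / r by field.
by rewrite pmulr_lge0 ?invr_gt0 // subr_ge0.
Qed.

(** * Inner products, operator norms and adjoint pairs *)

Section InnerProduct.
Variables (R : realType) (k : scalar_kind).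
Local Notation K := (scalar_field R k).
Variables (H : completeNormedModType K) (dot : {dot H for @scalar_conj R k}).
Hypothesis (Hnorm : norm_from_dot dot).
Implicit Types (f g h l : H) (a : K) (r : R) (A B : H -> H).
Local Notation N := (@real_norm R k H).
Local Notation ip f g := (scalar_Re (dot f g)).

Lemma dotC f g : dot f g = scalar_conj (dot g f).
Proof. by rewrite [LHS]hermitian_subproof expr0 mul1r. Qed.

Lemma dotDl f g h : dot (f + g) h = dot f h + dot g h.
Proof. exact: linearDl. Qed.

Lemma dotDr f g h : dot f (g + h) = dot f g + dot f h.
Proof. exact: linearDr. Qed.

Lemma dotNl f g : dot (- f) g = - dot f g.
Proof. exact: linearNl. Qed.

Lemma dotNr f g : dot f (- g) = - dot f g.
Proof. exact: linearNr. Qed.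

Lemma dotZl a f g : dot (a *: f) g = a * dot f g.
Proof. exact: linearZl_LR. Qed.

Lemma dotZr a f g : dot f (a *: g) = scalar_conj a * dot f g.
Proof. by rewrite dotC dotZl scalar_conjM -dotC. Qed.

Lemma dotBl f g h : dot (f - g) h = dot f h - dot g h.
Proof. by rewrite dotDl dotNl. Qed.

Lemma dotBr f g h : dot f (g - h) = dot f g - dot f h.
Proof. by rewrite dotDr dotNr. Qed.

Lemma ipC f g : ip f g = ip g f.
Proof. by rewrite dotC scalar_Re_conj. Qed.

Lemma dot_real_norm f : dot f f = scalar_of k (N f ^+ 2).
Proof. by rewrite -Hnorm norm_scalar_of !expr2 scalar_ofM. Qed.

Lemma ip_real_norm f : ip f f = N f ^+ 2.
Proof. by rewrite dot_real_norm scalar_ofK. Qed.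

(** A relation between bare functions: linearity is not assumed but follows, by [adjoint_linear]. *)
Definition adjoint_pair A B := forall f g, dot (A f) g = dot f (B g).

Lemma adjoint_pairC A B : adjoint_pair A B -> adjoint_pair B A.
Proof. by move=> AB f g; rewrite dotC -AB -dotC. Qed.

Lemma dot_inj f g : (forall h, dot f h = dot g h) -> f = g.
Proof.
move=> e; apply/eqP; rewrite -subr_eq0; apply/eqP/real_norm_eq0.
apply/eqP; rewrite -sqrf_eq0 -ip_real_norm dotBl e subrr scalar_Re0; exact: eqxx.
Qed.

Lemma adjoint_linear A B : adjoint_pair A B -> linear A.
Proof.
move=> AB a f g; apply: dot_inj => h.
by rewrite AB !dotDl !dotZl !AB.
Qed.

(** The form of [A] at [f - t g] is a nonnegative quadratic polynomial in the real variable [t]. *)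
Lemma positive_form_cauchy_schwarz A f g : adjoint_pair A A ->
  (forall h, 0 <= ip (A h) h) ->
  ip (A f) g ^+ 2 <= ip (A f) f * ip (A g) g.
Proof.
move=> AA A0; apply: sqr_le_of_quadratic_ge0 => // t.
have := A0 (f - scalar_of k t *: g).
rewrite AA dotBl dotZl -!AA !dotBr !dotZr !scalar_conj_of.
rewrite !(scalar_ReD, scalar_ReN, scalar_Re_ofM, mulrBr).
have -> : ip (A g) f = ip (A f) g by rewrite AA ipC.
by congr (_ <= _); ring.
Qed.

Lemma ip_cauchy_schwarz f g : ip f g <= N f * N g.
Proof.
have : ip f g ^+ 2 <= (N f * N g) ^+ 2.
  rewrite exprMn -!ip_real_norm.
  apply: (@positive_form_cauchy_schwarz id) => // h.
  by rewrite ip_real_norm sqr_ge0.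
have [//|lt_ip] := leP (ip f g) (N f * N g).
have NN : 0 <= N f * N g by rewrite mulr_ge0.
have ip0 := ltW (le_lt_trans NN lt_ip).
by rewrite ler_sqr ?nnegrE // leNgt lt_ip.
Qed.

(** Multiplying [f] by the conjugate of [dot f g] makes the inner product real, equal to
    [scalar_abs (dot f g) ^+ 2]; the bound on real parts then applies, and one factor cancels. *)
Lemma dot_cauchy_schwarz f g : scalar_abs (dot f g) <= N f * N g.
Proof.
set x := dot f g; have := ip_cauchy_schwarz (scalar_conj x *: f) g.
rewrite dotZl -/x mulrC scalar_mul_conj scalar_ofK real_normZ scalar_abs_conj.
have [->|x0] := eqVneq (scalar_abs x) 0; first by rewrite mulr_ge0.
by rewrite expr2 -mulrA ler_pM2l // lt_neqAle eq_sym x0 scalar_abs_ge0.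
Qed.

Lemma real_norm_le_dual f r : 0 <= r -> ip f f <= r * N f -> N f <= r.
Proof.
rewrite ip_real_norm => r0; have [->//|f0] := eqVneq (N f) 0.
by rewrite expr2 ler_pM2r // lt_neqAle eq_sym f0 real_norm_ge0.
Qed.

Definition norm_bounded r A := forall f, N (A f) <= r * N f.

(** A triple: [.1.1], [.1.2] and [.2] select the rules for sums, differences and scalar
    multiples. *)
Lemma linear_rules (A : H -> H) : linear A -> (forall f g, A (f + g) = A f + A g) *
  (forall f g, A (f - g) = A f - A g) * (forall a f, A (a *: f) = a *: A f).
Proof.
move=> lA.
have D f g : A (f + g) = A f + A g by have := lA 1 f g; rewrite !scale1r.
have A0 : A 0 = 0 by apply: (addIr (A 0)); rewrite -D !add0r.
have Z a f : A (a *: f) = a *: A f by have := lA a f 0; rewrite !addr0 A0 addr0.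
by do 2!split=> //; move=> f g; rewrite D -scaleN1r Z scaleN1r.
Qed.

Lemma opnorm_ge A f : real_norm f <= 1 -> ((N (A f))%:E <= opnorm A)%E.
Proof. by move=> f1; apply: ereal_sup_ubound; exists f. Qed.

Lemma opnorm_ge0 A : linear A -> (0 <= opnorm A)%E.
Proof.
move=> lA; apply: le_trans (@opnorm_ge A 0 _); first by rewrite lee_fin.
by rewrite real_norm0.
Qed.

Lemma opnorm_le r A : 0 <= r -> norm_bounded r A -> (opnorm A <= r%:E)%E.
Proof.
move=> r0 Ar; apply: ge_ereal_sup => _ [f /= f1 <-].
by rewrite lee_fin (le_trans (Ar f)) // -[X in _ <= X]mulr1 ler_wpM2l.
Qed.

Lemma norm_bounded_opnorm A : bounded_operator A ->
  exists r, [/\ 0 <= r, opnorm A = r%:E & norm_bounded r A].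
Proof.
move=> [lA Aoo]; have A0 := opnorm_ge0 lA.
have E : opnorm A = (fine (opnorm A))%:E.
  by rewrite fineK // ge0_fin_numE.
exists (fine (opnorm A)); split=> //; first exact: fine_ge0.
move=> f; have [f0|f0] := eqVneq (N f) 0.
  have -> : f = 0 by exact: real_norm_eq0.
  have := (linear_rules lA).1.2 0 0; rewrite !subrr => ->.
  by rewrite real_norm0 mulr0.
have fp : 0 < N f by rewrite lt_neqAle eq_sym f0 real_norm_ge0.
have fi : 0 <= (N f)^-1 by rewrite invr_ge0.
have := @opnorm_ge A (scalar_of k (N f)^-1 *: f).
rewrite (linear_rules lA).2 !real_normZof // mulVf // => /(_ (lexx _)).
by rewrite E lee_fin ler_pdivrMl // mulrC.
Qed.

Lemma bounded_operator_of r A B : adjoint_pair A B -> 0 <= r ->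
  norm_bounded r A -> bounded_operator A.
Proof.
move=> AB r0 Ar; split; first exact: adjoint_linear AB.
exact: le_lt_trans (opnorm_le r0 Ar) (ltry _).
Qed.

(** [N (B f) ^+ 2] is the real part of [dot (A (B f)) f], hence at most [r * N (B f) * N f]. *)
Lemma norm_bounded_adjoint r A B : 0 <= r -> adjoint_pair A B ->
  norm_bounded r A -> norm_bounded r B.
Proof.
move=> r0 AB Ar f; apply: real_norm_le_dual; first by rewrite mulr_ge0.
rewrite -AB (le_trans (ip_cauchy_schwarz _ _)) //.
by rewrite (le_trans (ler_wpM2r _ (Ar _))) // mulrAC.
Qed.

Lemma opnorm_adjoint A B : adjoint_pair A B -> bounded_operator A ->
  (opnorm B <= opnorm A)%E.
Proof.
move=> AB /norm_bounded_opnorm[r [r0 -> Ar]].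
exact: opnorm_le (norm_bounded_adjoint r0 AB Ar).
Qed.

(** [adjoint] is a choice; an exhibited bounded candidate shows that the choice succeeds, and
    nondegeneracy of [dot] forces it to be that candidate. *)
Lemma adjoint_eq A B : adjoint_pair A B -> bounded_operator B ->
  adjoint dot A = B.
Proof.
move=> AB bB; rewrite /adjoint; case: xgetP => [C _ [_ AC]|/(_ B)[]//].
apply/funext => g; apply: dot_inj => h.
by rewrite dotC -AC AB -dotC.
Qed.

Lemma adjoint_pair_id : adjoint_pair id id.
Proof. by []. Qed.

Lemma adjoint_pair_scale r A B : adjoint_pair A B ->
  adjoint_pair (fun f => scalar_of k r *: A f) (fun f => scalar_of k r *: B f).
Proof. by move=> AB f g; rewrite dotZl dotZr scalar_conj_of AB. Qed.

Lemma adjoint_pairD A B A' B' : adjoint_pair A B -> adjoint_pair A' B' ->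
  adjoint_pair (A \+ A') (B \+ B').
Proof. by move=> AB AB' f g; rewrite dotDl dotDr AB AB'. Qed.

Lemma adjoint_pairB A B A' B' : adjoint_pair A B -> adjoint_pair A' B' ->
  adjoint_pair (A \- A') (B \- B').
Proof. by move=> AB AB' f g; rewrite dotBl dotBr AB AB'. Qed.

Lemma adjoint_pair_comp A B A' B' : adjoint_pair A B -> adjoint_pair A' B' ->
  adjoint_pair (A \o A') (B' \o B).
Proof. by move=> AB AB' f g; rewrite /= AB AB'. Qed.

(** Real parts suffice: self-adjointness makes [dot (A f) f] invariant under conjugation. *)
Lemma positive_operator_of r A : adjoint_pair A A -> 0 <= r ->
  norm_bounded r A -> (forall f, 0 <= ip (A f) f) -> positive_operator dot A.
Proof.
move=> AA r0 Ar A0; split=> //; first exact: bounded_operator_of AA r0 Ar.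
by move=> f; apply: scalar_conj_ge0; rewrite // -dotC -AA.
Qed.

Lemma norm_tends_dotl (u : nat -> H) l g : norm_tends u l ->
  (fun n => scalar_abs (dot (u n) g - dot l g)) @ \oo --> (0 : R).
Proof.
move=> ul; apply: (@squeeze_cvgr _ _ _ _ (fun=> 0) (fun n => N (u n - l) * N g)).
- apply: nearW => n; rewrite scalar_abs_ge0 /= -dotBl.
  exact: dot_cauchy_schwarz.
- exact: cvg_cst.
- by rewrite -[X in _ --> X](mul0r (N g)); apply: cvgMl.
Qed.

Lemma adjoint_pair_lim (A_ B_ : nat -> H -> H) A B :
  (forall n, adjoint_pair (A_ n) (B_ n)) ->
  (forall f, norm_tends (A_ ^~ f) (A f)) ->
  (forall f, norm_tends (B_ ^~ f) (B f)) -> adjoint_pair A B.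
Proof.
move=> AB Al Bl f g; apply/eqP; rewrite -subr_eq0; apply/eqP/scalar_abs_eq0/eqP.
rewrite eq_le scalar_abs_ge0 andbT.
have lim : (fun n => scalar_abs (dot (A_ n f) g - dot (A f) g) +
    scalar_abs (dot (B_ n g) f - dot (B g) f)) @ \oo --> (0 : R).
  rewrite -[X in _ --> X](addr0 (0 : R)).
  by apply: cvgD; [exact: norm_tends_dotl (Al f) | exact: norm_tends_dotl (Bl g)].
apply: le_of_cvg0 lim _ => n; rewrite add0r.
rewrite -[X in X <= _]scalar_absN opprB.
(* The defect vanishes for every pair [A_ n], [B_ n], so only the two approximation errors
   remain. *)
have -> : dot f (B g) - dot (A f) g =
  (dot (A_ n f) g - dot (A f) g) - (dot f (B_ n g) - dot f (B g)).
  by rewrite AB; ring.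
apply: le_trans (scalar_absD _ _) _; rewrite lerD2l scalar_absN.
rewrite (dotC f (B_ n g)) (dotC f (B g)).
have <- : scalar_conj (dot (B_ n g) f - dot (B g) f) =
  scalar_conj (dot (B_ n g) f) - scalar_conj (dot (B g) f).
  by rewrite -!dotC -dotBr -dotBl -dotC.
by rewrite scalar_abs_conj.
Qed.

Lemma norm_tends_norm_bounded r A (u : nat -> H) l : linear A -> norm_bounded r A ->
  norm_tends u l -> norm_tends (A \o u) (A l).
Proof.
move=> lA Ar ul; apply: (@squeeze_cvgr _ _ _ _ (fun=> 0) (fun n => r * N (u n - l))).
- by apply: nearW => n; rewrite real_norm_ge0 /= -(linear_rules lA).1.2 Ar.
- exact: cvg_cst.
- by rewrite -[X in _ --> X](mulr0 r); apply: cvgMr.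
Qed.

End InnerProduct.

(** * Synthesis series of Bessel sequences and the operators [T_Phi U_Psi] *)

Section Bessel.
Variables (R : realType) (k : scalar_kind).
Local Notation K := (scalar_field R k).
Variables (H : completeNormedModType K) (dot : {dot H for @scalar_conj R k}).
Hypothesis (Hnorm : norm_from_dot dot).
Implicit Types (f g h : H) (c : nat -> K) (Phi Psi : nat -> H) (C M r : R).
Local Notation N := (@real_norm R k H).
Local Notation ip f g := (scalar_Re (dot f g)).
Local Notation abs2 x := (scalar_abs x ^+ 2).

Lemma scalar_Re_sum (I : Type) (s : seq I) (F : I -> K) :
  scalar_Re (\sum_(i <- s) F i) = \sum_(i <- s) scalar_Re (F i).
Proof. exact: (big_morph _ (@scalar_ReD R k) (@scalar_Re0 R k)). Qed.

Lemma dot_suml (I : Type) (s : seq I) (F : I -> H) g :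
  dot (\sum_(i <- s) F i) g = \sum_(i <- s) dot (F i) g.
Proof. exact: linear_sumlz. Qed.

Lemma bessel_partial_sum Phi M f n : is_bessel_bound dot Phi M ->
  \sum_(0 <= i < n) abs2 (dot f (Phi i)) <= M * N f ^+ 2.
Proof.
move=> [_ /(_ f)]; rewrite -lee_fin -sumEFin; apply: le_trans.
by apply: nneseries_lim_ge => i _ _; rewrite lee_fin sqr_ge0.
Qed.

(* AM-GM: [2 |c_i| |<s, phi_i>| <= M |c_i|^2 + |<s, phi_i>|^2 / M], summed with
   [s] the partial sum itself; the Bessel bound absorbs the last terms. *)
Lemma partial_synthesis_le Phi M c m n : (m <= n)%N -> is_bessel_bound dot Phi M ->
  N (\sum_(m <= i < n) c i *: Phi i) ^+ 2 <= M * \sum_(m <= i < n) abs2 (c i).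
Proof.
move=> mn bPhi; have M0 := bPhi.1; set s := \sum_(m <= i < n) _.
have Mn : M != 0 by rewrite gt_eqF.
have tail : \sum_(m <= i < n) abs2 (dot s (Phi i)) <= M * N s ^+ 2.
  rewrite (le_trans _ (bessel_partial_sum s n bPhi)) //.
  rewrite (big_cat_nat (leq0n m) mn) /= lerDr.
  by apply: sumr_ge0 => i _; rewrite sqr_ge0.
have : N s ^+ 2 *+ 2 <=
    M * \sum_(m <= i < n) abs2 (c i) + M^-1 * \sum_(m <= i < n) abs2 (dot s (Phi i)).
  rewrite -(ip_real_norm Hnorm) {1}/s dot_suml scalar_Re_sum -sumrMnl !big_distrr /=.
  rewrite -big_split /=; apply: ler_sum => i _.
  rewrite dotZl; apply: le_trans (_ : scalar_abs (c i) * scalar_abs (dot s (Phi i)) *+ 2 <= _).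
    rewrite lerMn2r /= (le_trans (scalar_Re_le_abs _)) // scalar_absM.
    by rewrite [dot (Phi i) s]dotC scalar_abs_conj.
  rewrite -subr_ge0; set x := scalar_abs _; set y := scalar_abs _.
  have -> : M * x ^+ 2 + M^-1 * y ^+ 2 - x * y *+ 2 = M^-1 * (M * x - y) ^+ 2 by field.
  by rewrite mulr_ge0 ?sqr_ge0 // invr_ge0 ltW.
have : M^-1 * \sum_(m <= i < n) abs2 (dot s (Phi i)) <= N s ^+ 2.
  by rewrite ler_pdivrMl.
by rewrite mulr2n; lra.
Qed.

(** Bounded partial sums of the squared coefficients converge, and [partial_synthesis_le] turns this
    into the Cauchy property of the vector series. *)
Lemma synthesis_tends Phi M c C : is_bessel_bound dot Phi M ->
  (forall n, \sum_(0 <= i < n) abs2 (c i) <= C) ->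
  norm_tends (series (fun i => c i *: Phi i)) (synthesis Phi c).
Proof.
move=> bPhi cC; have M0 := bPhi.1.
set s := series (fun i => abs2 (c i)).
have s_nd : nondecreasing_seq s.
  by apply: nondecreasing_series => i _ _; rewrite sqr_ge0.
have s_cvg : cvgn s.
  by apply: nondecreasing_is_cvgn => //; exists C => _ [n _ <-]; exact: cC.
set L := limn s.
have sL n : s n <= L by exact: nondecreasing_cvgn_le.
(* [M * (L - s m)] bounds the squared norm of every block of terms starting at [m]. *)
have v0 : (fun n => Num.sqrt (M * (L - s n))) @ \oo --> (0 : R).
  rewrite -[X in _ --> X]sqrtr0 -[X in _ --> Num.sqrt X](mulr0 M) -(subrr L).
  apply: (cvg_comp (fun n => M * (L - s n)) (@Num.sqrt R)); last exact: sqrt_continuous.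
  by apply: cvgMr; apply: cvgB => //; exact: cvg_cst.
have [|l ul] := @cauchy_norm_tends R k H (series (fun i => c i *: Phi i)) _ v0.
  move=> m n mn /=; rewrite sub_series mn.
  rewrite -[X in X <= _]ger0_norm // -sqrtr_sqr ler_wsqrtr //.
  apply: le_trans (partial_synthesis_le _ mn bPhi) _; rewrite ler_wpM2l ?(ltW M0) //.
  have -> : \sum_(m <= i < n) abs2 (c i) = s n - s m by rewrite /s sub_series mn.
  by rewrite lerD2r.
suff -> : synthesis Phi c = l by [].
by apply: cvg_lim; [exact: norm_hausdorff | apply/norm_tendsP].
Qed.

Lemma synthesis_le Phi M c C : is_bessel_bound dot Phi M ->
  (forall n, \sum_(0 <= i < n) abs2 (c i) <= C) ->
  N (synthesis Phi c) ^+ 2 <= M * C.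
Proof.
move=> bPhi cC; have M0 := bPhi.1.
have MC : 0 <= M * C.
  by rewrite mulr_ge0 ?(ltW M0) //; have := cC 0; rewrite big_geq.
rewrite -[M * C]sqr_sqrtr // ler_sqr ?nnegrE ?sqrtr_ge0 //.
apply: (real_norm_lim_le (synthesis_tends bPhi cC)) => n.
rewrite -[X in X <= _]ger0_norm // -sqrtr_sqr ler_wsqrtr //.
by rewrite (le_trans (partial_synthesis_le _ (leq0n n) bPhi)) // ler_wpM2l // ltW.
Qed.

Definition cross_operator Phi Psi : H -> H := synthesis Phi \o analysis dot Psi.

Definition partial_cross Phi Psi n f : H :=
  series (fun i => dot f (Psi i) *: Phi i) n.

(** The finite-rank version of [T_Phi U_Psi] and [T_Psi U_Phi] being adjoint; [cross_adjoint] passes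
    to the limit. *)
Lemma partial_cross_adjoint Phi Psi n :
  adjoint_pair dot (partial_cross Phi Psi n) (partial_cross Psi Phi n).
Proof.
move=> f g; rewrite /partial_cross; elim: n => [|n IH].
  by rewrite /series /= !big_geq // linear0l linear0r.
by rewrite !seriesSr dotDl dotDr IH dotZl dotZr -dotC mulrC.
Qed.

Lemma cross_tends Phi Psi M M' f : is_bessel_bound dot Phi M ->
  is_bessel_bound dot Psi M' ->
  norm_tends (partial_cross Phi Psi ^~ f) (cross_operator Phi Psi f).
Proof.
move=> bPhi bPsi; apply: (synthesis_tends bPhi (C := M' * N f ^+ 2)) => n.
exact: bessel_partial_sum.
Qed.

Lemma cross_adjoint Phi Psi M M' : is_bessel_bound dot Phi M ->
  is_bessel_bound dot Psi M' ->
  adjoint_pair dot (cross_operator Phi Psi) (cross_operator Psi Phi).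
Proof.
move=> bPhi bPsi; apply: (adjoint_pair_lim Hnorm (@partial_cross_adjoint Phi Psi)).
- by move=> f; exact: cross_tends bPhi bPsi.
- by move=> f; exact: cross_tends bPsi bPhi.
Qed.

Lemma partial_sum_frame_operator Phi n f :
  \sum_(0 <= i < n) abs2 (dot f (Phi i)) = ip (partial_cross Phi Phi n f) f.
Proof.
rewrite /partial_cross /series /= dot_suml scalar_Re_sum; apply: eq_bigr => i _.
by rewrite dotZl [dot (Phi i) f]dotC scalar_mul_conj scalar_ofK.
Qed.

(** The partial sums are the real parts of [dot (partial_cross Phi Phi n f) f], and the inner
    product is continuous. *)
Lemma cvg_frame_operator Phi M f : is_bessel_bound dot Phi M ->
  series (fun i => abs2 (dot f (Phi i))) @ \oo --> ip (frame_operator dot Phi f) f.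
Proof.
move=> bPhi; have h := norm_tends_dotl Hnorm f (cross_tends f bPhi bPhi).
apply/subr_cvg0; apply/norm_cvg0P.
apply: (@squeeze_cvgr _ _ _ _ (fun=> 0)); last exact: h.
- apply: nearW => n; rewrite normr_ge0 /= ler_norml /=.
  have -> : series (fun i => abs2 (dot f (Phi i))) n - ip (frame_operator dot Phi f) f
      = scalar_Re (dot (partial_cross Phi Phi n f) f - dot (frame_operator dot Phi f) f).
    by rewrite scalar_ReD scalar_ReN -partial_sum_frame_operator.
  rewrite scalar_Re_le_abs andbT lerNl -scalar_ReN.
  by rewrite (le_trans (scalar_Re_le_abs _)) // scalar_absN.
- exact: cvg_cst.
Qed.

Lemma square_sum_frame_operator Phi M f : is_bessel_bound dot Phi M ->
  square_sum dot Phi f = (ip (frame_operator dot Phi f) f)%:E.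
Proof.
move=> /cvg_frame_operator - /(_ f) h; apply: cvg_lim => //.
have -> : (fun n => \sum_(0 <= i < n) (abs2 (dot f (Phi i)))%:E)%E =
  EFin \o series (fun i => abs2 (dot f (Phi i))).
  by apply/funext => n; rewrite sumEFin.
by apply: cvg_EFin => //; exact: nearW.
Qed.

(** The squared coefficients [dot f (Phi i)] sum to the form of the frame operator at [f], which
    serves as the constant [C] in [synthesis_le]. This is the source of the bound on [D D^*]. *)
Lemma cross_frame_le Phi Psi M M' f : is_bessel_bound dot Phi M ->
  is_bessel_bound dot Psi M' ->
  N (cross_operator Psi Phi f) ^+ 2 <= M' * ip (frame_operator dot Phi f) f.
Proof.
move=> bPhi bPsi; apply: synthesis_le => // n.
have h := cvg_frame_operator (f := f) bPhi; rewrite -(cvg_lim (@Rhausdorff R) h).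
apply: (@nondecreasing_cvgn_le _ (series (fun i => abs2 (dot f (Phi i))))).
  by apply: nondecreasing_series => i _ _; rewrite sqr_ge0.
by apply/cvg_ex; eexists; exact: h.
Qed.

Lemma cross_bounded Phi Psi M M' : is_bessel_bound dot Phi M ->
  is_bessel_bound dot Psi M' ->
  norm_bounded (Num.sqrt (M * M')) (cross_operator Phi Psi).
Proof.
move=> bPhi bPsi f; have M0 := bPhi.1; have M'0 := bPsi.1.
rewrite -ler_sqr ?nnegrE ?mulr_ge0 ?sqrtr_ge0 // exprMn sqr_sqrtr; last first.
  by rewrite mulr_ge0 // ltW.
by rewrite -mulrA; apply: synthesis_le => // n; exact: bessel_partial_sum.
Qed.

End Bessel.

(** * Neumann iteration and positive square roots *)

Section SquareRoot.
Variables (R : realType) (k : scalar_kind).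
Local Notation K := (scalar_field R k).
Variables (H : completeNormedModType K) (dot : {dot H for @scalar_conj R k}).
Hypothesis (Hnorm : norm_from_dot dot).
Implicit Types (f g : H) (A B S : H -> H) (q r m M : R).
Local Notation N := (@real_norm R k H).
Local Notation ip f g := (scalar_Re (dot f g)).
Local Notation scal r f := (scalar_of k r *: f).

(** The solution is the limit of the iterates of the contraction sending [f] to [A f + g]. *)
Lemma neumann_surjective A q : linear A -> 0 <= q -> q < 1 -> norm_bounded q A ->
  forall g, exists f, f - A f = g.
Proof.
move=> lA q0 q1 Aq g; pose u n := iter n (fun f => A f + g) 0.
have uS n : u n.+1 = A (u n) + g by [].
have step n : N (u n.+1 - u n) <= N (u 1%N - u 0) * q ^+ n.
  elim: n => [|n IH]; first by rewrite expr0 mulr1.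
  rewrite [u n.+2]uS [in X in _ - X]uS opprD addrACA subrr addr0.
  rewrite -(linear_rules lA).1.2 (le_trans (Aq _)) // exprS mulrCA.
  by rewrite ler_wpM2l.
have [f uf] := geometric_norm_tends q0 q1 step; exists f.
have lim : (fun n => N (u n.+1 - f) + N (A (u n) - A f)) @ \oo --> (0 : R).
  rewrite -[X in _ --> X](addr0 (0 : R)); apply: cvgD.
    by move: uf; rewrite /norm_tends -(cvg_shiftS (fun n => N (u n - f))).
  exact: norm_tends_norm_bounded lA Aq uf.
apply: (eq_of_norm_le lim) => n.
have -> : f - A f - g = (A (u n) - A f) - (u n.+1 - f).
by rewrite uS opprB opprD [RHS](AC (2*(1*2)) ((3*2*5)*(1*4))) /= subrr addr0.
by rewrite [X in _ <= X]addrC; exact: real_normB.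
Qed.

Section Iteration.
Variables (B : H -> H) (q : R).
Hypotheses (q_ge0 : 0 <= q) (q_lt1 : q < 1).
Hypotheses (B_adjoint : adjoint_pair dot B B) (B_bounded : norm_bounded q B).

(* Iterates of [Y |-> (B + Y^2) / 2], a contraction of ratio [q] on operators of
   norm at most [q]; at the fixed point, [(1 - Y)^2 = 1 - B]. *)
Fixpoint root_iter n : H -> H :=
  if n is n'.+1 then fun f => scal 2^-1 (B f + root_iter n' (root_iter n' f))
  else fun=> 0.

Lemma root_iter_adjoint n : adjoint_pair dot (root_iter n) (root_iter n).
Proof.
elim: n => [|n IH] /=; first by move=> f g; rewrite linear0l linear0r.
apply: adjoint_pair_scale; apply: adjoint_pairD => //.
exact: adjoint_pair_comp.
Qed.

Let root_iter_linear n := linear_rules (adjoint_linear Hnorm (root_iter_adjoint n)).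

Lemma root_iter_bounded n : norm_bounded q (root_iter n).
Proof.
elim: n => [|n IH] f /=; first by rewrite real_norm0 mulr_ge0.
rewrite real_normZof ?invr_ge0 // ler_pdivrMl //.
apply: le_trans (real_normD _ _) _; rewrite mulr2n mulrDl mul1r lerD //.
apply: le_trans (IH _) _; apply: ler_wpM2l => //.
apply: le_trans (IH _) _; apply: ler_piMl => //; exact: ltW.
Qed.

(** With consecutive iterates [Y] and [Z], [Y Y - Z Z = (Y - Z) Y + Z (Y - Z)]. Each summand gains a
    factor [q], and the scalar 1/2 absorbs there being two; the induction needs all [f] because it
    is applied at [Y f]. *)
Lemma root_iter_step n f :
  N (root_iter n.+1 f - root_iter n f) <= N f * q ^+ n.
Proof.
elim: n f => [|n IH] f.
  rewrite /= !addr0 subr0 expr0 mulr1 real_normZof ?invr_ge0 // ler_pdivrMl //.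
  have := B_bounded f; have : q * N f <= N f by apply: ler_piMl => //; exact: ltW.
  by have := real_norm_ge0 f; lra.
rewrite [root_iter n.+2]/= [X in _ - X]/= -scalerBr opprD addrACA subrr add0r.
rewrite real_normZof ?invr_ge0 // ler_pdivrMl //.
set Y := root_iter n.+1; set Z := root_iter n.
have -> : Y (Y f) - Z (Z f) = (Y (Y f) - Z (Y f)) + Z (Y f - Z f).
  by rewrite [Z (Y f - Z f)](root_iter_linear n).1.2 addrA subrK.
apply: le_trans (real_normD _ _) _; rewrite mulr2n mulrDl mul1r lerD //.
  apply: le_trans (IH _) _; rewrite exprS mulrA ler_wpM2r ?exprn_ge0 // mulrC.
  exact: root_iter_bounded.
apply: le_trans (root_iter_bounded _ _) _; by rewrite exprS mulrCA ler_wpM2l.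
Qed.

Lemma exists_root : exists Y : H -> H, [/\ adjoint_pair dot Y Y, norm_bounded q Y &
  forall f, scal 2 (Y f) = B f + Y (Y f)].
Proof.
have /choice[Y Yl] f : exists l, norm_tends (root_iter ^~ f) l.
  exact: geometric_norm_tends q_ge0 q_lt1 (root_iter_step ^~ f).
have YY := adjoint_pair_lim Hnorm root_iter_adjoint Yl Yl.
have Yq : norm_bounded q Y.
  by move=> f; apply: (real_norm_lim_le (Yl f)) => n; exact: root_iter_bounded.
exists Y; split=> // f.
(* Three errors: in [2 Y f], in replacing the inner iterate by [Y f], and of the outer iterate at
   the fixed vector [Y f]. The uniform bound [q] on iterates controls the second, so pointwise
   convergence is enough. *)
have lim : (fun n => 2 * N (root_iter n.+1 f - Y f) +
    (q * N (root_iter n f - Y f) + N (root_iter n (Y f) - Y (Y f)))) @ \oo --> (0 : R).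
  rewrite -[X in _ --> X](addr0 (0 : R)); apply: cvgD.
    rewrite -[X in _ --> X](mulr0 2); apply: cvgMr.
    by have := Yl f; rewrite /norm_tends -(cvg_shiftS (fun n => N (root_iter n f - Y f))).
  rewrite -[X in _ --> X](addr0 (0 : R)); apply: cvgD; last exact: Yl.
  by rewrite -[X in _ --> X](mulr0 q); apply: cvgMr; exact: Yl.
apply: (eq_of_norm_le lim) => n; set Z := root_iter n.
have ZB x y : Z (x - y) = Z x - Z y by exact: (root_iter_linear n).1.2.
have -> : scal 2 (Y f) - (B f + Y (Y f)) =
    (Z (Z f - Y f) + (Z (Y f) - Y (Y f))) - scal 2 (root_iter n.+1 f - Y f).
  rewrite scalerBr /= scalerA -scalar_ofM mulfV // scalar_of1 scale1r.
  rewrite ZB addrA subrK -/Z opprB !opprD.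
  by rewrite [RHS](AC (2*(1*2)) ((3*(4*2))*(1*5))) /= subrr addr0.
rewrite [X in _ <= X]addrC; apply: le_trans (real_normB _ _) _.
rewrite real_normZof // lerD2r.
by apply: le_trans (real_normD _ _) _; rewrite lerD2r; exact: root_iter_bounded.
Qed.

End Iteration.

(** * Inverting, and taking the root of, an operator between two positive multiples of the
    identity *)

Section BoundedBelow.
Variables (S : H -> H) (m M : R).
Hypotheses (m_gt0 : 0 < m) (M_gt0 : 0 < M) (S_adjoint : adjoint_pair dot S S).
Hypothesis S_bounds : forall f, m * N f ^+ 2 <= ip (S f) f <= M * N f ^+ 2.

Local Notation B := (fun f => f - scal (M + m)^-1 (S f)).

(* The denominator is [M + m] rather than [M]: in the zero space nothing forces
   [m <= M], and [q] must be nonnegative. *)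
Local Notation q := (M / (M + m)).

Let Mm_gt0 : 0 < M + m. Proof. exact: addr_gt0. Qed.
Let q_ge0 : 0 <= q. Proof. by rewrite divr_ge0 // ltW. Qed.
Let q_lt1 : q < 1. Proof. by rewrite ltr_pdivrMr // mul1r ltrDl. Qed.

Let B_adjoint : adjoint_pair dot B B.
Proof.
apply: adjoint_pairB; [exact: adjoint_pair_id | exact: adjoint_pair_scale].
Qed.

(** The upper bound on [S] makes [B] nonnegative, and the lower bound gives the factor
    [1 - m / (M + m) = q]. *)
Let B_form f : 0 <= ip (B f) f <= q * N f ^+ 2.
Proof.
rewrite dotBl dotZl scalar_ReD scalar_ReN scalar_Re_ofM (ip_real_norm Hnorm).
have /andP[Sm SM] := S_bounds f; have Mn : M + m != 0 by rewrite gt_eqF.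
rewrite subr_ge0 ler_pdivrMl // (le_trans SM) /=; last first.
  by rewrite mulrDl lerDl mulr_ge0 ?sqr_ge0 // ltW.
have -> : q * N f ^+ 2 = N f ^+ 2 - (M + m)^-1 * (m * N f ^+ 2) by field.
by rewrite lerD2l lerN2 ler_wpM2l // invr_ge0 ltW.
Qed.

(** Cauchy-Schwarz for the form of [B] at [f] and [B f] gives [N (B f) ^+ 4 <= (q * N f ^+ 2) * (q *
    N (B f) ^+ 2)]. *)
Let B_bounded : norm_bounded q B.
Proof.
move=> f; have [->|Bf0] := eqVneq (N (B f)) 0; first by rewrite mulr_ge0.
have Bfp : 0 < N (B f) by rewrite lt_neqAle eq_sym Bf0 real_norm_ge0.
have B0 h : 0 <= ip (B h) h by have /andP[] := B_form h.
have : (N (B f) ^+ 2) ^+ 2 <= (q * N f * N (B f)) ^+ 2.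
  rewrite -[X in X ^+ 2 <= _](ip_real_norm Hnorm).
  apply: le_trans (positive_form_cauchy_schwarz _ _ B_adjoint B0) _.
  apply: le_trans (ler_pM (B0 _) (B0 _) (andP (B_form _)).2 (andP (B_form _)).2) _.
  by rewrite le_eqVlt; apply/orP; left; apply/eqP; ring.
have qN : 0 <= q * N f * N (B f) by apply: mulr_ge0 => //; apply: mulr_ge0.
by rewrite ler_sqr ?nnegrE ?sqr_ge0 // expr2 ler_pM2r.
Qed.

Lemma bounded_below_surjective g : exists f, S f = g.
Proof.
have [f] := neumann_surjective (adjoint_linear Hnorm B_adjoint) q_ge0 q_lt1
  B_bounded (scal (M + m)^-1 g).
rewrite opprB addrCA subrr addr0 => /scalerI cS; exists f; apply: cS.
by rewrite gt_eqF // -(scalar_of0 R k) scalar_of_lt invr_gt0.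
Qed.

Lemma exists_positive_sqrt : exists Q, positive_operator dot Q /\ Q \o Q = S.
Proof.
have [Y [YY Yq Y2]] := exists_root q_ge0 q_lt1 B_adjoint B_bounded.
have lY := linear_rules (adjoint_linear Hnorm YY).
have s0 : 0 <= Num.sqrt (M + m) by exact: sqrtr_ge0.
(* [S] is [M + m] times [1 - B], and [1 - Y] is a root of [1 - B]; its positivity comes from [Y]
   being bounded by [q < 1]. *)
exists (fun f => scal (Num.sqrt (M + m)) (f - Y f)); split.
  apply: (positive_operator_of Hnorm (r := Num.sqrt (M + m) * (1 + q))).
  - apply: adjoint_pair_scale; apply: adjoint_pairB => //; exact: adjoint_pair_id.
  - by rewrite mulr_ge0 // addr_ge0.
  - move=> f; rewrite real_normZof // -mulrA ler_wpM2l // mulrDl mul1r.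
    by rewrite (le_trans (real_normB _ _)) // lerD2l Yq.
  - move=> f; rewrite dotZl scalar_Re_ofM mulr_ge0 // dotBl scalar_ReD scalar_ReN.
    rewrite (ip_real_norm Hnorm) subr_ge0.
    rewrite (le_trans (ip_cauchy_schwarz Hnorm _ _)) // expr2 ler_wpM2r //.
    by rewrite (le_trans (Yq f)) // ler_piMl // ltW.
apply/funext => f /=.
rewrite lY.2 -scalerBr scalerA -scalar_ofM -expr2 sqr_sqrtr ?ltW // lY.1.2.
(* This is [(1 - Y)^2 = 1 - 2 Y + Y^2 = 1 - B], by the fixed-point equation [2 Y = B + Y^2]. *)
have -> : f - Y f - (Y f - Y (Y f)) = scal (M + m)^-1 (S f).
  have -> : Y (Y f) = Y f + Y f - (f - scal (M + m)^-1 (S f)).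
    rewrite -[Y f + Y f]/(Y f *+ 2) -scaler_nat -[2%:R]/(1 + 1) -scalar_of1.
    by rewrite -scalar_ofD Y2 [X in _ = X - _]addrC addrK.
  rewrite !opprB; set w := scal _ _.
  rewrite (AC (2*((2*2)*1)) ((5*(1*6))*(3*2)*(4*7))) /=.
  by rewrite !subrr !addr0.
by rewrite scalerA -scalar_ofM mulfV ?gt_eqF // scalar_of1 scale1r.
Qed.

End BoundedBelow.
End SquareRoot.

(** * The frame operator and the inverse of its square root *)

Section FrameOperator.
Variables (R : realType) (k : scalar_kind).
Local Notation K := (scalar_field R k).
Variables (H : completeNormedModType K) (dot : {dot H for @scalar_conj R k}).
Hypothesis (Hnorm : norm_from_dot dot).
Implicit Types (f g : H) (Phi Psi : nat -> H).
Local Notation N := (@real_norm R k H).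
Local Notation ip f g := (scalar_Re (dot f g)).

Lemma frame_operator_bounds Phi : frame dot Phi ->
  exists m M : R, [/\ 0 < m, is_bessel_bound dot Phi M & forall f,
    m * N f ^+ 2 <= ip (frame_operator dot Phi f) f <= M * N f ^+ 2].
Proof.
move=> [m [M [m0 M0 mM]]].
have bPhi : is_bessel_bound dot Phi M by split=> // f; have /andP[] := mM f.
exists m, M; split=> // f; have := mM f.
by rewrite (square_sum_frame_operator Hnorm f bPhi) !lee_fin.
Qed.

(** [P] plays the role of [S_Phi^{-1/2}]. It is chosen as a right inverse of [Q], which is onto
    because [Q \o Q] is; the lower frame bound makes [P] bounded. *)
Lemma frame_sqrt_inverse Phi : frame dot Phi ->
  let Q := sqrt_operator dot (frame_operator dot Phi) in
  exists (P : H -> H) (r : R), [/\ 0 <= r, cancel P Q, adjoint_pair dot P P,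
    norm_bounded r P &
    forall g, ip (frame_operator dot Phi (P g)) (P g) = N g ^+ 2].
Proof.
move=> frPhi Q; have [m [M [m0 bPhi mM]]] := frame_operator_bounds frPhi.
have SS := cross_adjoint Hnorm bPhi bPhi.
have [Q0 Q0P] := exists_positive_sqrt Hnorm m0 bPhi.1 SS mM.
have [[_ QQ _] QE] : positive_operator dot Q /\ Q \o Q = frame_operator dot Phi.
  by rewrite /Q /sqrt_operator; case: xgetP => [//|/(_ Q0)].
have /choice[P QP] g : exists f, Q f = g.
  have [f <-] := bounded_below_surjective Hnorm m0 bPhi.1 SS mM g.
  by exists (Q f); exact: (congr1 (fun A => A f) QE).
have PP : adjoint_pair dot P P.
  (* [<P f, g> = <P f, Q P g> = <Q P f, P g> = <f, P g>]. *)
  by move=> f g; rewrite -{1}(QP g) -QQ QP.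
have SP g : ip (frame_operator dot Phi (P g)) (P g) = N g ^+ 2.
  by rewrite -QE /= QQ QP (ip_real_norm Hnorm).
exists P, (Num.sqrt m^-1); split=> //.
move=> g; rewrite -ler_sqr ?nnegrE ?mulr_ge0 ?sqrtr_ge0 // exprMn sqr_sqrtr.
  by rewrite ler_pdivlMl // -(SP g); have /andP[] := mM (P g).
by rewrite invr_ge0 ltW.
Qed.

End FrameOperator.

(** * Approximate duality and factorization through the square root *)

Theorem lemma2p2 (R : realType) (k : scalar_kind)
    (H : completeNormedModType (scalar_field R k))
    (dot : {dot H for @scalar_conj R k})
    (Hnorm : norm_from_dot dot) (Hsep : separable_space H)
    (Phi Psi : nat -> H) (MPhi MPsi : R)
    (Phi_frame : frame dot Phi) (Psi_frame : frame dot Psi)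
    (Phi_bound : is_bessel_bound dot Phi MPhi)
    (Psi_bound : is_bessel_bound dot Psi MPsi) :
  approximately_dual dot Phi Psi <->
  exists D : H -> H,
    [/\ bounded_operator D,
        synthesis Phi \o analysis dot Psi =
          sqrt_operator dot (frame_operator dot Phi) \o D,
        le_operator dot (D \o adjoint dot D) (fun f => scalar_of k MPsi *: f) &
        (opnorm (idfun \- (sqrt_operator dot (frame_operator dot Phi) \o D))%R
           < 1)%E].
Proof.
have crossE Phi' Psi' : synthesis Phi' \o analysis dot Psi' =
  cross_operator dot Phi' Psi' by [].
rewrite /approximately_dual !crossE.
set Q := sqrt_operator _ _; set X := cross_operator dot Phi Psi.
set X' := cross_operator dot Psi Phi.
have XX' : adjoint_pair dot X X' := cross_adjoint Hnorm Phi_bound Psi_bound.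
split=> [[_ _ near_id]|[D [_ XE _ D1]]]; last first.
  by split; [exists MPhi | exists MPsi | left; rewrite XE].
have MM0 : 0 <= Num.sqrt (MPhi * MPsi) by exact: sqrtr_ge0.
have Xb : norm_bounded _ X := cross_bounded Hnorm Phi_bound Psi_bound.
have [P [r [r0 QP PP Pr SP]]] := frame_sqrt_inverse Hnorm Phi_frame.
have XE : X = Q \o (P \o X) by apply/funext => f; exact/esym/QP.
have DD' : adjoint_pair dot (P \o X) (X' \o P) := adjoint_pair_comp PP XX'.
have a0 : 0 <= r * Num.sqrt (MPhi * MPsi) by exact: mulr_ge0.
have Db : norm_bounded (r * Num.sqrt (MPhi * MPsi)) (P \o X).
  by move=> f; rewrite (le_trans (Pr _)) // -mulrA ler_wpM2l.
have D'b := norm_bounded_adjoint Hnorm a0 DD' Db.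
have D'D := adjoint_pairC DD'.
exists (P \o X); split=> //.
- exact (bounded_operator_of Hnorm DD' a0 Db).
- rewrite /le_operator (adjoint_eq Hnorm DD'); last first.
    exact (bounded_operator_of Hnorm D'D a0 D'b).
  have M0 := ltW Psi_bound.1; set a := r * _ in a0 Db D'b.
  (* A crude norm bound for [MPsi - D D^*], from the triangle inequality; [a] bounds both [D] and
     its adjoint. *)
  apply: (positive_operator_of Hnorm (r := MPsi + a * a)).
  + apply: adjoint_pairB; last exact: adjoint_pair_comp DD' D'D.
    by apply: adjoint_pair_scale; exact: adjoint_pair_id.
  + by rewrite addr_ge0 // mulr_ge0.
  + move=> f; rewrite (le_trans (real_normB _ _)) // mulrDl real_normZof // lerD2l.
    by rewrite (le_trans (Db _)) // -mulrA ler_wpM2l.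
  + move=> f; rewrite dotBl dotZl scalar_ReD scalar_ReN scalar_Re_ofM.
    (* The form of [D D^*] at [f] becomes [N (X' (P f)) ^+ 2], and [SP] rewrites [N f ^+ 2] as the
       form of the frame operator at [P f]. *)
    rewrite [dot (((P \o X) \o _) f) f]DD' !(ip_real_norm Hnorm) subr_ge0 -(SP f).
    exact (cross_frame_le Hnorm (P f) Phi_bound Psi_bound).
(* The first alternative is the goal. In the second, [idfun \- X] is the adjoint of [idfun \- X'],
   so its norm is no larger. *)
- rewrite -XE; case: near_id => // X'1; apply: le_lt_trans X'1.
  have idX := adjoint_pairB (adjoint_pair_id dot) XX'.
  have idX' := adjoint_pairC idX.
  apply: (opnorm_adjoint Hnorm idX').
  apply: (bounded_operator_of Hnorm idX' (r := 1 + Num.sqrt (MPhi * MPsi))).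
    by rewrite addr_ge0.
  move=> f; rewrite (le_trans (real_normB _ _)) // mulrDl mul1r lerD2l.
  exact (norm_bounded_adjoint Hnorm MM0 XX' Xb f).
Qed.
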